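(* Let $B\subseteq A$ be an extension of $\Bbbk$-algebras such that $A/AJ(B)A$, as a left $A$-module, is $(A,B)$-projective. Then: (1) $\operatorname{pd}_{A/AJ(B)A}M=\operatorname{pd}_{(A,B)}M$ for every $A/AJ(B)A$-module $M$ (finitely generated, viewed as an $A$-module on the right-hand side); (2) $\operatorname{gldim}\bigl(A/AJ(B)A\bigr)\le\operatorname{gldim}(A,B)$; and (3) if $\operatorname{gldim}\bigl(A/AJ(B)A\bigr)$ is infinite, then $B\subseteq A$ is controllable, i.e. $\operatorname{gldim}(A,B)=\operatorname{gldim}(A/AJ(B)A)$.
   Context: Throughout, $\Bbbk$ is a perfect field and all algebras are Artin algebras over $\Bbbk$ (finite-dimensional, associative, unital). An extension $B\subseteq A$ is an algebra $A$ with a unital subalgebra $B$. $J(A)$ is the Jacobson radical, $AJ(B)A$ is the two-sided ideal of $A$ generated by $J(B)$, and $A\text{-mod}$ is the category of finitely generated left $A$-modules. $\operatorname{pd}_C$ and $\operatorname{gldim}(C)$ are the ordinary projective and global dimensions for an algebra $C$. A module $M\in A\text{-mod}$ is $(A,B)$-projective if the multiplication map $A\otimes_B M\to M$ is a split epimorphism of $A$-modules. An $(A,B)$-exact sequence is a complex of $A$-modules $(M_n,d_n)$ admitting a $B$-homotopy, i.e. $B$-linear maps $h_n:M_n\to M_{n+1}$ with $d_{n+1}h_n+h_{n-1}d_n=1_{M_n}$ for all $n$. An $(A,B)$-projective resolution of $M$ is an $(A,B)$-exact sequence $\cdots\to P_1\to P_0\to M\to 0$ with all $P_i$ being $(A,B)$-projective.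 $\operatorname{pd}_{(A,B)}M$ is the least length of such a resolution (of $P_\bullet$), or $\infty$, and $\operatorname{gldim}(A,B)=\sup\{\operatorname{pd}_{(A,B)}M : M\in A\text{-mod}\}$. *)

(* Defs.v *)
From HB Require Import structures.
From mathcomp Require Import all_boot all_order all_algebra all_field.
From mathcomp Require Import boolp classical_sets.
From mathcomp Require Import ring_quotient.
From mathcomp.multinomials Require Import freeg.

Set Implicit Arguments.
Unset Strict Implicit.
Unset Printing Implicit Defensive.

Import GRing.Theory.

Local Open Scope ring_scope.
Local Open Scope quotient_scope.
Local Open Scope classical_set_scope.

(* [None] is infinity. *)
Definition enat := option nat.

Definition enat_le (x y : enat) : bool :=
  match x, y with
  | _, None => true
  | None, Some _ => false
  | Some m, Some n => (m <= n)%N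
  end.

Definition least (S : set nat) : enat :=
  if pselect (exists n, `[< S n >]) is left exS then Some (ex_minn exS)
  else None.

Definition enat_sup (E : set enat) : enat :=
  least [set n | forall x, E x -> enat_le x (Some n)].

Definition perfect_field (k : fieldType) : Prop :=
  forall p : {poly k}, irreducible_poly p -> separable_poly p.

Definition fin_gen (R : pzRingType) (M : lmodType R) : Prop :=
  exists (n : nat) (g : 'I_n -> M),
    forall x, exists c : 'I_n -> R, x = \sum_(i < n) c i *: g i.

Definition projective (R : pzRingType) (P : lmodType R) : Prop :=
  forall (X Y : lmodType R) (g : {linear X -> Y}) (f : {linear P -> Y}),
    (forall y, exists x, g x = y) ->
    exists h : {linear P -> X}, forall p, g (h p) = f p.

Definition restr_type (R S : pzRingType) (f : {rmorphism R -> S}) (M : lmodType S) :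
  Type := M.

Section RestrictionOfScalars.
Variables (R S : pzRingType) (f : {rmorphism R -> S}) (M : lmodType S).

HB.instance Definition _ := GRing.Zmodule.on (restr_type f M).

Definition restr_scale (a : R) (m : restr_type f M) : restr_type f M := f a *: (m : M).

Lemma restr_scaleA a b m :
  restr_scale a (restr_scale b m) = restr_scale (a * b) m.
Proof. by rewrite /restr_scale rmorphM scalerA. Qed.

Lemma restr_scale1 : left_id 1 restr_scale.
Proof. by move=> m; rewrite /restr_scale rmorph1 scale1r. Qed.

Lemma restr_scaleDr : right_distributive restr_scale +%R.
Proof. by move=> a x y; rewrite /restr_scale scalerDr. Qed.

Lemma restr_scaleDl m : {morph restr_scale^~ m : a b / a + b}.
Proof. by move=> a b; rewrite /restr_scale rmorphD scalerDl. Qed.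

HB.instance Definition _ := GRing.Zmodule_isLmodule.Build R (restr_type f M)
  restr_scaleA restr_scale1 restr_scaleDr restr_scaleDl.

Definition restr : lmodType R := GRing.Lmodule.clone R (restr_type f M) _.
End RestrictionOfScalars.

Section Ideals.
Variable R : pzRingType.

Definition left_ideal (I : set R) : Prop :=
  [/\ I 0, forall x y, I x -> I y -> I (x + y)
    & forall a x, I x -> I (a * x)].

Definition two_sided_ideal (I : set R) : Prop :=
  left_ideal I /\ forall a x, I x -> I (x * a).

Definition maximal_left_ideal (I : set R) : Prop :=
  [/\ left_ideal I, I <> setT
    & forall K, left_ideal K -> I `<=` K -> K = I \/ K = setT].

Definition jacobson : set R := \bigcap_(I in maximal_left_ideal) I.

Definition ideal_gen (S : set R) : set R := smallest two_sided_ideal S.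

Lemma ideal_gen_ideal S : two_sided_ideal (ideal_gen S).
Proof.
split; [split|].
- by move=> I [[[]]].
- by move=> x y Ix Iy I hI; case: (hI) => -[[_ h _] _] _; apply: h;
    [apply: Ix|apply: Iy].
- by move=> a x Ix I hI; case: (hI) => -[[_ _ h] _] _; apply: h; apply: Ix.
- by move=> a x Ix I hI; case: (hI) => -[_ h] _; apply: h; apply: Ix.
Qed.

Definition ideal_mem (S : set R) : {pred R} := fun x => `[< ideal_gen S x >].

Lemma ideal_mem_zmod S : zmod_closed (ideal_mem S).
Proof.
have [[h0 hD hM] _] := ideal_gen_ideal S.
split; first exact/asboolP.
move=> x y /asboolP hx /asboolP hy; apply/asboolP.
by rewrite -mulN1r; apply: hD => //; apply: hM.
Qed.

HB.instance Definition _ S := GRing.isZmodClosed.Build R (ideal_mem S)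
  (ideal_mem_zmod S).

End Ideals.

Section QuotientRing.
Variables (R : pzRingType) (S : set R).

Definition quot_type : Type := {ideal_quot (ideal_mem S)}.

HB.instance Definition _ := GRing.Zmodule.on quot_type.

Definition quot_proj (x : R) : quot_type := \pi_({ideal_quot (ideal_mem S)}) x.

Lemma quot_projP x y : quot_proj x = quot_proj y <-> ideal_gen S (x - y).
Proof.
split; first by move/eqP; rewrite -Quotient.idealrBE => /asboolP.
by move=> h; apply/eqP; rewrite -Quotient.idealrBE; apply/asboolP.
Qed.

Lemma quot_projB : zmod_morphism quot_proj.
Proof. by move=> x y; rewrite /quot_proj raddfB. Qed.

HB.instance Definition _ :=
  GRing.isZmodMorphism.Build R quot_type quot_proj quot_projB.

Definition quot_repr (u : quot_type) : R := repr (u : {ideal_quot (ideal_mem S)}).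

Lemma quot_reprK : cancel quot_repr quot_proj.
Proof. by move=> u; rewrite /quot_proj /quot_repr reprK. Qed.

Definition quot_mul (u v : quot_type) : quot_type :=
  quot_proj (quot_repr u * quot_repr v).

Lemma quot_projM x y : quot_proj (x * y) = quot_mul (quot_proj x) (quot_proj y).
Proof.
apply/quot_projP; set x' := quot_repr _; set y' := quot_repr _.
have [[_ hD hl] hr] := ideal_gen_ideal S.
have hx : ideal_gen S (x - x') by apply/quot_projP; rewrite quot_reprK.
have hy : ideal_gen S (y - y') by apply/quot_projP; rewrite quot_reprK.
rewrite (_ : x * y - _ = (x - x') * y + x' * (y - y')); last first.
  by rewrite mulrBl mulrBr addrA subrK.
by apply: hD; [apply: hr|apply: hl].
Qed.

Lemma quot_mulA : associative quot_mul.
Proof.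
move=> u v w; rewrite -[u]quot_reprK -[v]quot_reprK -[w]quot_reprK.
by rewrite -!quot_projM mulrA.
Qed.

Lemma quot_mul1l : left_id (quot_proj 1) quot_mul.
Proof. by move=> u; rewrite -[u]quot_reprK -quot_projM mul1r. Qed.

Lemma quot_mul1r : right_id (quot_proj 1) quot_mul.
Proof. by move=> u; rewrite -[u]quot_reprK -quot_projM mulr1. Qed.

Lemma quot_mulDl : left_distributive quot_mul +%R.
Proof.
move=> u v w; rewrite -[u]quot_reprK -[v]quot_reprK -[w]quot_reprK.
by rewrite -raddfD -!quot_projM -raddfD mulrDl.
Qed.

Lemma quot_mulDr : right_distributive quot_mul +%R.
Proof.
move=> u v w; rewrite -[u]quot_reprK -[v]quot_reprK -[w]quot_reprK.
by rewrite -raddfD -!quot_projM -raddfD mulrDr.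
Qed.

HB.instance Definition _ := GRing.Zmodule_isPzRing.Build quot_type
  quot_mulA quot_mul1l quot_mul1r quot_mulDl quot_mulDr.

Lemma quot_proj_monoid : monoid_morphism quot_proj.
Proof. by split=> // x y; rewrite quot_projM. Qed.

HB.instance Definition _ :=
  GRing.isMonoidMorphism.Build R quot_type quot_proj quot_proj_monoid.

(* The quotient of [R] by the two-sided ideal generated by [S]; it is the zero
   ring when that ideal is [R]. *)
Definition quot_ring : pzRingType := GRing.PzRing.clone quot_type _.

Definition quot_map : {rmorphism R -> quot_ring} :=
  GRing.RMorphism.clone R quot_ring quot_proj _.
End QuotientRing.

(* A complex ... -> term 1 -> term 0 -> M -> 0. *)
Record augmented (R : pzRingType) (M : lmodType R) := Augmented {
  term : nat -> lmodType R;
  bd : forall n, {linear term n.+1 -> term n};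
  aug : {linear term 0%N -> M};
  aug_bd : forall x, aug (bd 0%N x) = 0;
  bd_bd : forall n x, bd n (bd n.+1 x) = 0
}.

Section ProjectiveDimension.
Variable R : pzRingType.

Definition exact (M : lmodType R) (C : augmented M) : Prop :=
  [/\ forall m, exists x, aug C x = m,
      forall x, aug C x = 0 -> exists y, bd C 0 y = x
    & forall n x, bd C n x = 0 -> exists y, bd C n.+1 y = x].

Definition length_le (M : lmodType R) (C : augmented M) (n : nat) : Prop :=
  forall i, (n < i)%N -> forall x : term C i, x = 0.

(* Resolutions are taken in the category of finitely generated modules. *)
Definition proj_resolution (M : lmodType R) (C : augmented M) : Prop :=
  exact C /\ forall n, fin_gen (term C n) /\ projective (term C n).

Definition pd (M : lmodType R) : enat :=
  least [set n | exists C : augmented M, proj_resolution C /\ length_le C n].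

Definition gldim : enat :=
  enat_sup [set d | exists M : lmodType R, fin_gen M /\ d = pd M].
End ProjectiveDimension.

(* [S] tensored over [R] with the left [R]-module [M], where [S] is a right
   [R]-module through [f]: the free abelian group on [S * M] modulo the
   subgroup generated by the balancing relations, with [S] acting on the left
   factor. *)
Section Tensor.
Variables (R S : pzRingType) (f : {rmorphism R -> S}) (M : lmodType R).

Local Notation gen x m := (Freeg [:: (1 : int, (x, m))] : {freeg (S * M)}).

Inductive tensor_rel : {freeg (S * M)} -> Prop :=
| tensor_rel0 : tensor_rel 0
| tensor_relB u v : tensor_rel u -> tensor_rel v -> tensor_rel (u - v)
| tensor_rel_addl x y m : tensor_rel (gen (x + y) m - (gen x m + gen y m))
| tensor_rel_addr x m n : tensor_rel (gen x (m + n) - (gen x m + gen x n))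
| tensor_rel_bal x r m : tensor_rel (gen (x * f r) m - gen x (r *: m)).

Definition tensor_mem : {pred {freeg (S * M)}} := fun u => `[< tensor_rel u >].

Lemma tensor_mem_zmod : zmod_closed tensor_mem.
Proof.
split; first by apply/asboolP; constructor.
by move=> u v /asboolP hu /asboolP hv; apply/asboolP; constructor.
Qed.

HB.instance Definition _ :=
  GRing.isZmodClosed.Build {freeg (S * M)} tensor_mem tensor_mem_zmod.

Definition tensor_type : Type := {ideal_quot tensor_mem}.

HB.instance Definition _ := GRing.Zmodule.on tensor_type.

Definition tensor_proj (u : {freeg (S * M)}) : tensor_type := \pi_({ideal_quot tensor_mem}) u.
Definition tensor_repr (t : tensor_type) : {freeg (S * M)} :=
  repr (t : {ideal_quot tensor_mem}).

Lemma tensor_reprK : cancel tensor_repr tensor_proj.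
Proof. by move=> t; rewrite /tensor_proj /tensor_repr reprK. Qed.

Lemma tensor_projP u v : tensor_proj u = tensor_proj v <-> tensor_rel (u - v).
Proof.
split; first by move/eqP; rewrite -Quotient.idealrBE => /asboolP.
by move=> h; apply/eqP; rewrite -Quotient.idealrBE; apply/asboolP.
Qed.

Lemma tensor_projB : zmod_morphism tensor_proj.
Proof. by move=> x y; rewrite /tensor_proj raddfB. Qed.

HB.instance Definition _ :=
  GRing.isZmodMorphism.Build {freeg (S * M)} tensor_type tensor_proj tensor_projB.

Definition tens (x : S) (m : M) : tensor_type := tensor_proj (gen x m).

Definition freeg_act (a : S) : {freeg (S * M)} -> {freeg (S * M)} :=
  fglift (fun p : S * M => gen (a * p.1) p.2).

Lemma freeg_actB a : zmod_morphism (freeg_act a).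
Proof. exact: lift_is_additive. Qed.

HB.instance Definition _ a :=
  GRing.isZmodMorphism.Build _ _ (freeg_act a) (freeg_actB a).

Lemma freeg_act_gen a x m : freeg_act a (gen x m) = gen (a * x) m.
Proof. by rewrite /freeg_act liftU scale1r. Qed.

Lemma freeg_act_rel a u : tensor_rel u -> tensor_rel (freeg_act a u).
Proof.
elim=> [|{}u v _ hu _ hv|x y m|x m n|x r m].
- by rewrite raddf0; constructor.
- by rewrite raddfB; constructor.
- by rewrite raddfB raddfD /= !freeg_act_gen mulrDr; constructor.
- by rewrite raddfB raddfD /= !freeg_act_gen; constructor.
- by rewrite raddfB /= !freeg_act_gen mulrA; constructor.
Qed.

Definition tensor_scale (a : S) (t : tensor_type) : tensor_type :=
  tensor_proj (freeg_act a (tensor_repr t)).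

Lemma tensor_scaleE a u :
  tensor_scale a (tensor_proj u) = tensor_proj (freeg_act a u).
Proof.
apply/tensor_projP; rewrite -raddfB; apply: freeg_act_rel; apply/tensor_projP.
by rewrite tensor_reprK.
Qed.

Lemma freeg_ind (P : {freeg (S * M)} -> Prop) :
  P 0 -> (forall u v, P u -> P v -> P (u - v)) -> (forall x m, P (gen x m)) ->
  forall u, P u.
Proof.
move=> P0 PB Pg u; have PN v : P v -> P (- v).
  by move=> Pv; rewrite -sub0r; apply: PB.
have PD v w : P v -> P w -> P (v + w).
  by move=> Pv Pw; rewrite -[w]opprK; apply: PB => //; apply: PN.
have Pn v n : P v -> P (v *+ n).
  by move=> Pv; elim: n => [|n IH]; rewrite ?mulr0n // mulrS; apply: PD.
rewrite -[u]freeg_sumE; elim/big_ind: _ => // -[x m] _.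
set c := coeff _ _; rewrite -[c]intz -freegU_mulz; case: c => n; first exact: Pn.
by rewrite NegzE mulrNz; apply: PN; apply: Pn.
Qed.

Lemma tensor_type_ind (P : tensor_type -> Prop) :
  P 0 -> (forall t u, P t -> P u -> P (t - u)) -> (forall x m, P (tens x m)) ->
  forall t, P t.
Proof.
move=> P0 PB Pt t; rewrite -[t]tensor_reprK.
elim/freeg_ind: (tensor_repr t) => [|u v Pu Pv|x m]; rewrite ?raddf0 ?raddfB //.
  exact: PB.
exact: Pt.
Qed.

Lemma tensor_scaleB a : zmod_morphism (tensor_scale a).
Proof.
move=> t u; rewrite -[t]tensor_reprK -[u]tensor_reprK.
by rewrite -raddfB !tensor_scaleE !raddfB.
Qed.

HB.instance Definition _ a :=
  GRing.isZmodMorphism.Build tensor_type tensor_type (tensor_scale a) (tensor_scaleB a).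

Lemma tensor_scale_tens a x m : tensor_scale a (tens x m) = tens (a * x) m.
Proof. by rewrite tensor_scaleE freeg_act_gen. Qed.

Lemma tens_addl x y m : tens (x + y) m = tens x m + tens y m.
Proof. by rewrite /tens -raddfD; apply/tensor_projP; constructor. Qed.

Lemma tens_addr x m n : tens x (m + n) = tens x m + tens x n.
Proof. by rewrite /tens -raddfD; apply/tensor_projP; constructor. Qed.

Lemma tens_bal x r m : tens (x * f r) m = tens x (r *: m).
Proof. by apply/tensor_projP; constructor. Qed.

Lemma tensor_scaleA a b t :
  tensor_scale a (tensor_scale b t) = tensor_scale (a * b) t.
Proof.
elim/tensor_type_ind: t => [|t u ht hu|x m]; first by rewrite !raddf0.
  by rewrite !raddfB /= ht hu.
by rewrite !tensor_scale_tens mulrA.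
Qed.

Lemma tensor_scale1 : left_id 1 tensor_scale.
Proof.
elim/tensor_type_ind => [|t u ht hu|x m]; first by rewrite raddf0.
  by rewrite raddfB /= ht hu.
by rewrite tensor_scale_tens mul1r.
Qed.

Lemma tensor_scaleDr : right_distributive tensor_scale +%R.
Proof. by move=> a t u; rewrite raddfD. Qed.

Lemma tensor_scaleDl t : {morph tensor_scale^~ t : a b / a + b}.
Proof.
move=> a b; elim/tensor_type_ind: t => [|t u ht hu|x m].
- by rewrite !raddf0 addr0.
- by rewrite !raddfB /= ht hu opprD addrACA.
- by rewrite !tensor_scale_tens mulrDl tens_addl.
Qed.

HB.instance Definition _ := GRing.Zmodule_isLmodule.Build S tensor_type
  tensor_scaleA tensor_scale1 tensor_scaleDr tensor_scaleDl.

Definition tensor : lmodType S := GRing.Lmodule.clone S tensor_type _.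

Lemma tensor_ind (P : tensor -> Prop) :
  P 0 -> (forall t u, P t -> P u -> P (t - u)) -> (forall x m, P (tens x m)) ->
  forall t, P t.
Proof. exact: tensor_type_ind. Qed.

Lemma scale_tens a x m : a *: (tens x m : tensor) = tens (a * x) m.
Proof. exact: tensor_scale_tens. Qed.
End Tensor.

(* The multiplication map S (x)_R M -> M sending [tens x m] to [x *: m]. *)
Section Multiplication.
Variables (R S : pzRingType) (f : {rmorphism R -> S}) (M : lmodType S).

Definition freeg_mult (u : {freeg (S * restr f M)}) : M :=
  fglift (fun p : S * restr f M => (p.1 *: (p.2 : M) : zmodule M)) u.

Definition tensor_mult (t : tensor f (restr f M)) : M :=
  freeg_mult (tensor_repr t).

Lemma freeg_multB : zmod_morphism freeg_mult.
Proof.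
exact: (@lift_is_additive int (S * restr f M)%type (zmodule M)).
Qed.

HB.instance Definition _ :=
  GRing.isZmodMorphism.Build _ _ freeg_mult freeg_multB.

Lemma freeg_mult_rel u : tensor_rel f u -> freeg_mult u = 0.
Proof.
have gE x m : freeg_mult (Freeg [:: (1 : int, (x, m))]) = x *: (m : M).
  by rewrite /freeg_mult liftU; exact: mulr1z.
elim=> [|{}u v _ hu _ hv|x y m|x m n|x r m].
- by rewrite raddf0.
- by rewrite raddfB /= hu hv subrr.
- by rewrite raddfB raddfD /= !gE scalerDl subrr.
- by rewrite raddfB raddfD /= !gE scalerDr subrr.
- by rewrite raddfB /= !gE -scalerA subrr.
Qed.

Lemma tensor_multE u : tensor_mult (tensor_proj f u) = freeg_mult u.
Proof.
apply/eqP; rewrite -subr_eq0 -raddfB; apply/eqP/freeg_mult_rel/tensor_projP.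
by rewrite tensor_reprK.
Qed.

Lemma tensor_mult_tens x m : tensor_mult (tens f x m) = x *: (m : M).
Proof. by rewrite tensor_multE /freeg_mult liftU; exact: mulr1z. Qed.

Lemma tensor_multB : zmod_morphism tensor_mult.
Proof.
move=> t u; rewrite -[t]tensor_reprK -[u]tensor_reprK.
by rewrite -raddfB !tensor_multE raddfB.
Qed.

HB.instance Definition _ :=
  GRing.isZmodMorphism.Build _ _ tensor_mult tensor_multB.

Lemma tensor_multZ : scalable tensor_mult.
Proof.
move=> a t; elim/tensor_ind: t => [|t u ht hu|x m].
- by rewrite scaler0 raddf0 scaler0.
- by rewrite !raddfB /= ht hu.
- by rewrite scale_tens !tensor_mult_tens scalerA.
Qed.

HB.instance Definition _ :=
  GRing.isScalable.Build S (tensor f (restr f M)) M *:%R tensor_mult tensor_multZ.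
End Multiplication.

(* The notions relative to the ring morphism [f : R -> S]; an extension
   corresponds to the inclusion of the subring. *)
Section Relative.
Variables (R S : pzRingType) (f : {rmorphism R -> S}).

Definition rel_projective (P : lmodType S) : Prop :=
  exists s : {linear P -> tensor f (restr f P)},
    forall p, tensor_mult (s p) = p.

(* The [R]-linear homotopy contracting ... -> P_1 -> P_0 -> M -> 0 has
   components M -> P_0 and P_n -> P_(n+1); the component starting from the
   final 0 vanishes. *)
Definition rel_exact (M : lmodType S) (C : augmented M) : Prop :=
  exists (s : {linear restr f M -> restr f (term C 0)})
         (h : forall n,
            {linear restr f (term C n) -> restr f (term C n.+1)}),
    [/\ forall m, aug C (s m) = m,
        forall x, bd C 0 (h 0%N x) + s (aug C x) = x
      & forall n x, bd C n.+1 (h n.+1 x) + h n (bd C n x) = x].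

Definition rel_proj_resolution (M : lmodType S) (C : augmented M) : Prop :=
  rel_exact C /\ forall n, fin_gen (term C n) /\ rel_projective (term C n).

Definition rel_pd (M : lmodType S) : enat :=
  least [set n |
    exists C : augmented M, rel_proj_resolution C /\ length_le C n].

Definition rel_gldim : enat :=
  enat_sup [set d | exists M : lmodType S, fin_gen M /\ d = rel_pd M].
End Relative.

Section Extension.
Variables (k : fieldType) (A : algType k) (B : subalgClosed A).

Record subalg_type := Subalg { subalg_val : A; _ : subalg_val \in B }.

HB.instance Definition _ := [isSub for subalg_val].
HB.instance Definition _ := [Choice of subalg_type by <:].
HB.instance Definition _ := GRing.SubChoice_isSubPzRing.Build A _ subalg_type
  (GRing.subalg_closedBM (GRing.subalgClosedP B)).

Definition subalg : pzRingType := GRing.PzRing.clone subalg_type _.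

Definition incl : {rmorphism subalg -> A} :=
  GRing.RMorphism.clone subalg A val _.

(* The quotient A / A J(B) A. *)
Definition quot_radical : pzRingType := quot_ring (incl @` @jacobson subalg).

Definition quot_radical_map : {rmorphism A -> quot_radical} :=
  quot_map (incl @` @jacobson subalg).

Definition controllable : Prop := rel_gldim incl = gldim quot_radical.
End Extension.

(* Main.v *)
(* Put [Abar = A / A J(B) A]. Abar-modules restrict to modules over the
   semisimple ring [B / J(B)], so an exact sequence of Abar-modules is
   (A,B)-exact; since Abar is (A,B)-projective, every finitely generated
   projective Abar-module is too. Hence a projective resolution [Q] of an
   Abar-module [M] is also an (A,B)-projective resolution. Conversely let [D] be
   an (A,B)-projective resolution of [M] of length [n], and compare it with [Q]
   by chain maps [F : Q -> D] and [G : D -> Q]. As [G F] is homotopic to the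
   identity and factors through [0] in degrees above [n], the homotopy [h]
   satisfies [d h d = d] on [Q_(n+1)], so [1 - d h] is an idempotent of [Q_n]
   whose image can replace [Q_n] in a projective resolution of length [n]. *)

From HB Require Import structures.
Require Import Defs.
From mathcomp Require Import all_boot all_order all_algebra all_field.
From mathcomp Require Import boolp classical_sets.
From mathcomp.multinomials Require Import freeg.

Set Implicit Arguments.
Unset Strict Implicit.
Unset Printing Implicit Defensive.

Import GRing.Theory.

Local Open Scope ring_scope.
Local Open Scope classical_set_scope.

(** * Preliminaries: bundled linear maps and dependent choice *)

Definition linear_pack (R : pzRingType) (U V : lmodType R) (f : U -> V)
  (hf : linear f) : {linear U -> V} :=
  HB.pack f (GRing.isLinear.Build R U V *:%R f hf).

(** Builds chain maps and resolutions degree by degree: [P] is the invariant kept in each degree,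
    [Q] the compatibility of consecutive degrees. *)
Lemma dep_choice (T : nat -> Type) (P : forall n, T n -> Prop)
    (Q : forall n, T n -> T n.+1 -> Prop) :
  (exists x, P 0%N x) ->
  (forall n x, P n x -> exists2 y, P n.+1 y & Q n x y) ->
  exists u : forall n, T n,
    (forall n, P n (u n)) /\ forall n, Q n (u n) (u n.+1).
Proof.
move=> /cid[x0 Px0] step.
have step' n (x : {x : T n | P n x}) :
    {y : {y : T n.+1 | P n.+1 y} | Q n (sval x) (sval y)}.
  by case: x => x Px; have [y Py Qy] := cid2 (step n x Px); exists (exist _ y Py).
pose v := nat_rect (fun n => {x : T n | P n x}) (exist _ x0 Px0)
  (fun n x => sval (step' n x)).
exists (fun n => sval (v n)); split=> n; first exact: svalP.
exact: (svalP (step' n (v n))).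
Qed.

(** * Semisimplicity of modules killed by the radical of a left Artinian ring *)

Section Semisimplicity.
Variable R : pzRingType.

Definition submod (M : lmodType R) (N : set M) : Prop :=
  [/\ N 0, forall x y, N x -> N y -> N (x + y)
    & forall a x, N x -> N (a *: x)].

Lemma submodB (M : lmodType R) (N : set M) x y :
  submod N -> N x -> N y -> N (x - y).
Proof.
by case=> _ ND NZ Nx Ny; apply: ND => //; rewrite -scaleN1r; apply: NZ.
Qed.

Definition left_artinian : Prop :=
  forall F : set (set R), (forall L, F L -> left_ideal L) -> F !=set0 ->
    exists2 L, F L & forall L', F L' -> L' `<=` L -> L `<=` L'.

Hypothesis artR : left_artinian.

(* A left ideal [K] minimal among those not inside [N] meets [N] in [J(R)]:
   if [r] in [K] and [N] avoids a maximal left ideal [m], then [m] and [K] meet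
   inside [N] by minimality, while [R = m + R r] gives [K = (m & K) + R r]. *)
Lemma left_ideal_jacobson_complement (N : set R) : left_ideal N -> ~ N 1 ->
  exists2 y, ~ N y & forall r, N (r * y) -> jacobson (r * y).
Proof.
move=> [N0 ND NM] N1.
have NB x y : N x -> N y -> N (x - y).
  by move=> Nx Ny; apply: ND => //; rewrite -mulN1r; apply: NM.
case: (@artR [set L | left_ideal L /\ ~ L `<=` N]) => [L []//||K].
  by exists setT; split; [split|move=> /(_ 1 I)].
move=> [[K0 KD KM] KN] Kmin.
have KB x y : K x -> K y -> K (x - y).
  by move=> Kx Ky; apply: KD => //; rewrite -mulN1r; apply: KM.
have /existsNP[y /not_implyP[Ky Ny]] := KN.
exists y => // r0 Nr m [[m0 mD mM] mT mmax]; set r := r0 * y in Nr *.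
have Kr : K r by apply: KM.
apply: contrapT => mr; apply: Ny.
have mK : m `&` K `<=` N.
  apply: contrapT => mKN; apply: mr.
  suff: (m `&` K) r by case.
  apply: Kmin Kr => [|x []//]; split=> //.
  split=> // [x z [mx Kx] [mz Kz]|a x [mx Kx]].
    by split; [apply: mD|apply: KD].
  by split; [apply: mM|apply: KM].
have [] := mmax [set x | exists u s, m u /\ x = u + s * r].
- split.
  + by exists 0, 0; rewrite mul0r addr0.
  + move=> _ _ [u [s [mu ->]]] [u' [s' [mu' ->]]].
    by exists (u + u'), (s + s'); rewrite mulrDl addrACA; split=> //; apply: mD.
  + move=> a _ [u [s [mu ->]]]; exists (a * u), (a * s).
    by rewrite mulrDr mulrA; split=> //; apply: mM.
- by move=> u mu; exists u, 0; rewrite mul0r addr0.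
- move=> E; case: mr; rewrite -E; exists 0, 1; rewrite mul1r add0r.
  by split.
move=> E; have [u [s [mu Eus]]] : [set x | exists u s, m u /\ x = u + s * r] 1.
  by rewrite E.
have Eu : y * u = y - y * s * r by rewrite -[X in X - _]mulr1 Eus mulrDr mulrA addrK.
have -> : y = y * u + y * s * r by rewrite Eu subrK.
apply: ND; last exact: NM.
apply: mK; split; first exact: mM.
by rewrite Eu; apply: KB => //; apply: KM.
Qed.

Definition jacobson_trivial (M : lmodType R) : Prop :=
  forall r, jacobson r -> forall x : M, r *: x = 0.

(** Zorn gives [N] maximal among those meeting [K] only in [0]. If [x] is not in [K + N], the left
    ideal [L] of all [r] with [r x] in [K + N] is proper, so some [y] outside [L] has [r y] in the
    radical whenever [r y] is in [L]. Then [r y x = 0], hence [N + R y x] still meets [K] trivially,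
    against maximality. *)
Lemma submod_complement (M : lmodType R) (K : set M) :
  jacobson_trivial M -> submod K ->
  exists N : set M, [/\ submod N, forall x, K x -> N x -> x = 0
    & forall x, exists2 n, N n & K (x - n)].
Proof.
move=> JM [K0 KD KZ].
(* [P] does not ask for [N 0], since the empty chain has empty union; maximality gives it
   afterwards, by adjoining [0]. *)
pose P (N : set M) := [/\ forall x y, N x -> N y -> N (x + y),
  forall a x, N x -> N (a *: x) & forall x, K x -> N x -> x = 0].
have [|N [[ND NZ NK] Nmax]] := @Zorn_bigcup M P.
  move=> F FP tot; split.
  - move=> x y [X FX Xx] [Y FY Yy].
    case: (tot _ _ FX FY) => [XY|YX]; [exists Y|exists X] => //.
      by have [+ _ _] := FP _ FY; apply=> //; apply: XY.
    by have [+ _ _] := FP _ FX; apply=> //; apply: YX.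
  - move=> a x [X FX Xx]; exists X => //.
    by have [_ + _] := FP _ FX; apply.
  - move=> x Kx [X FX Xx].
    by have [_ _ +] := FP _ FX; apply.
have N0 : N 0.
  apply: contrapT => N0; apply: (Nmax (N `|` [set 0])).
    split=> [x Nx|sub]; first by left.
    by apply: N0; apply: sub; right.
  split.
  - move=> x y [Nx|->] [Ny|->]; rewrite ?addr0 ?add0r; try by left.
      by left; apply: ND.
    by right.
  - move=> a x [Nx|->]; first by left; apply: NZ.
    by right; rewrite scaler0.
  - by move=> x Kx [Nx|->//]; apply: NK.
exists N; split=> // x.
pose L := [set r : R | exists2 n, N n & K (r *: x - n)].
have Lideal : left_ideal L.
  split.
  - by exists 0 => //; rewrite scale0r subr0.
  - move=> a b [n Nn Kn] [m Nm Km]; exists (n + m); first exact: ND.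
    by rewrite scalerDl opprD addrACA; apply: KD.
  - move=> a b [n Nn Kn]; exists (a *: n); first exact: NZ.
    by rewrite -scalerA -scalerBr; apply: KZ.
have [[n Nn]|L1] := pselect (L 1); first by rewrite scale1r; exists n.
have [y Ly Hy] := left_ideal_jacobson_complement Lideal L1.
exfalso; apply: (Nmax [set z | exists2 n, N n & exists r, z = n + r *: (y *: x)]).
  split=> [z Nz|sub]; first by exists z => //; exists 0; rewrite scale0r addr0.
  apply: Ly; exists (y *: x); last by rewrite subrr.
  by apply: sub; exists 0 => //; exists 1; rewrite scale1r add0r.
split.
- move=> _ _ [n Nn [r ->]] [m Nm [s ->]]; exists (n + m); first exact: ND.
  by exists (r + s); rewrite scalerDl addrACA.
- move=> a _ [n Nn [r ->]]; exists (a *: n); first exact: NZ.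
  by exists (a * r); rewrite scalerDr -[in RHS]scalerA.
- move=> z Kz [n Nn [r Ez]]; rewrite {z}Ez in Kz *.
  have r0 : r *: (y *: x) = 0.
    rewrite scalerA; apply: JM; apply: Hy; exists (- n).
      by rewrite -scaleN1r; apply: NZ.
    by rewrite opprK -scalerA addrC.
  by move: Kz; rewrite r0 addr0 => Kn; apply: NK.
Qed.

(** Take complements [N] of the kernel and [N'] of the image of [g]. Then [g] is bijective from [N]
    to its image, and [t] inverts it after projecting along [N']; uniqueness of the value [t y]
    makes [t] linear. *)
Lemma linear_pseudo_inverse (X Y : lmodType R) (g : {linear X -> Y}) :
  jacobson_trivial X -> jacobson_trivial Y ->
  exists t : {linear Y -> X}, forall x, g (t (g x)) = g x.
Proof.
move=> JX JY.
have [|N [Nsub NK Ndec]] := @submod_complement X [set x | g x = 0] JX.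
  split=> /= [|x y gx gy|a x gx]; first by rewrite raddf0.
    by rewrite raddfD /= gx gy addr0.
  by rewrite linearZ /= gx scaler0.
have [|N' [N'sub N'K N'dec]] := @submod_complement Y (range g) JY.
  split=> /= [|_ _ [x _ <-] [y _ <-]|a _ [x _ <-]].
  - by exists 0; rewrite ?raddf0.
  - by exists (x + y); rewrite ?raddfD.
  - by exists (a *: x); rewrite ?linearZ.
have /choice[t ht] y : exists n, N n /\ N' (y - g n).
  have [n' Nn' [x _ gx]] := N'dec y; have [n Nn gn] := Ndec x.
  exists n; split=> //; move/eqP: gn; rewrite linearB subr_eq0 => /eqP <-.
  by rewrite gx opprB addrC subrK.
have tuniq y n : N n -> N' (y - g n) -> t y = n.
  move=> Nn N'n; have [Nt N't] := ht y.
  apply/eqP; rewrite -subr_eq0; apply/eqP; apply: NK; last exact: submodB.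
  apply: N'K; first by exists (t y - n).
  rewrite linearB [X in N' X](_ : _ = (y - g n) - (y - g (t y))); last first.
    by rewrite opprB [RHS]addrC addrA subrK.
  exact: submodB.
have tlin : linear t.
  move=> a y z; have [Ny N'y] := ht y; have [Nz N'z] := ht z.
  have [_ ND NZ] := Nsub; have [_ N'D N'Z] := N'sub.
  apply: tuniq; first by apply: ND => //; apply: NZ.
  by rewrite linearP opprD addrACA -scalerBr; apply: N'D => //; apply: N'Z.
exists (linear_pack tlin) => x /=.
have [_ N'x] := ht (g x); apply/esym/eqP; rewrite -subr_eq0; apply/eqP.
by apply: N'K N'x; exists (x - t (g x)); rewrite ?linearB.
Qed.
End Semisimplicity.

(** * Relative projectivity as a lifting property *)

Section RelativeLifting.
Variables (R S : pzRingType) (f : {rmorphism R -> S}).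

Lemma restr_linearZ (N : lmodType R) (X : lmodType S)
    (u : {linear N -> restr f X}) r m :
  u (r *: m) = f r *: (u m : X) :> X.
Proof. by rewrite (linearZ_LR u). Qed.

(** Existence half of the adjunction between tensoring up along [f] and restriction. *)
Lemma tensor_lift (N : lmodType R) (X : lmodType S)
    (u : {linear N -> restr f X}) :
  exists h : {linear tensor f N -> X},
    forall a n, h (tens f a n) = a *: (u n : X).
Proof.
pose F (w : {freeg (S * N)}) : X :=
  fglift (fun p : S * N => (p.1 *: (u p.2 : X) : zmodule X)) w.
have FB : zmod_morphism F by exact: (@lift_is_additive int (S * N)%type (zmodule X)).
pose Fa : {additive {freeg (S * N)} -> X} :=
  HB.pack F (GRing.isZmodMorphism.Build _ _ F FB).
have FE a n : Fa (Freeg [:: (1 : int, (a, n))]) = a *: (u n : X).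
  by rewrite /= /F liftU; exact: mulr1z.
have Frel w : tensor_rel f w -> Fa w = 0.
  elim=> [|{}w v _ hw _ hv|x y m|x m n|x r m].
  - by rewrite raddf0.
  - by rewrite raddfB hw hv subrr.
  - by rewrite raddfB raddfD !FE scalerDl subrr.
  - by rewrite raddfB raddfD !FE raddfD /= scalerDr subrr.
  - by rewrite raddfB !FE restr_linearZ -scalerA subrr.
pose h (t : tensor f N) : X := Fa (tensor_repr t).
have hE w : h (tensor_proj f w) = Fa w.
  apply/eqP; rewrite -subr_eq0 -raddfB; apply/eqP/Frel/tensor_projP.
  by rewrite tensor_reprK.
have hT a n : h (tens f a n) = a *: (u n : X) by rewrite hE FE.
have hB : zmod_morphism h.
  move=> t t'; rewrite -[t]tensor_reprK -[t']tensor_reprK.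
  by rewrite -raddfB !hE raddfB.
pose ha : {additive tensor f N -> X} :=
  HB.pack h (GRing.isZmodMorphism.Build _ _ h hB).
have hZ : scalable h.
  move=> a t; rewrite -[h]/(ha : _ -> _); elim/tensor_ind: t => [|t t' ht ht'|x m].
  - by rewrite scaler0 raddf0 scaler0.
  - by rewrite !raddfB ht ht'.
  - by rewrite scale_tens /= !hT scalerA.
have hlin : linear h.
  by move=> a x y; rewrite -[h]/(ha : _ -> _) raddfD /= hZ.
by exists (linear_pack hlin).
Qed.

(** The [R]-linear [v] has to split [g] only over the image of [u]. This suits differentials, which
    split over cycles, without turning the cycles into a module. *)
Definition rel_lifting (P : lmodType S) : Prop :=
  forall (X Y : lmodType S) (g : {linear X -> Y}) (u : {linear P -> Y})
    (v : {linear restr f Y -> restr f X}),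
    (forall p, g (v (u p)) = u p) ->
    exists h : {linear P -> X}, forall p, g (h p) = u p.

Definition restr_linear (X Y : lmodType S) (g : {linear X -> Y}) :
    {linear restr f X -> restr f Y} :=
  @linear_pack R (restr f X) (restr f Y) g (fun a x y => linearP g (f a) x y).

(** Forward, [v u] extends by adjunction to the tensor product and is composed with [s]. Backward,
    the identity is lifted along the multiplication map, which [p |-> 1 (x) p] splits over [R]. *)
Lemma rel_projectiveP (P : lmodType S) : rel_projective f P <-> rel_lifting P.
Proof.
split=> [[s hs] X Y g u v hv|lift].
  have [w hw] := tensor_lift (v \o restr_linear u).
  exists (w \o s) => p /=.
  suff E t : g (w t) = u (tensor_mult t) by rewrite E hs.
  elim/tensor_ind: t => [|t t' ht ht'|x m].
  - by rewrite !raddf0.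
  - by rewrite !raddfB /= ht ht'.
  - by rewrite hw tensor_mult_tens !linearZ /= hv.
have ilin : linear (fun p : restr f P => tens f 1 p : restr f (tensor f (restr f P))).
  move=> a x y; rewrite tens_addr; congr (_ + _).
  by rewrite -tens_bal mul1r -[f a]mulr1 -scale_tens.
have [p|s hs] := lift _ _ (@tensor_mult R S f P) idfun (linear_pack ilin).
  by rewrite /= tensor_mult_tens scale1r.
by exists s.
Qed.
End RelativeLifting.

(** * Cycles, comparison maps and homotopies for relative resolutions *)

Section Cycles.
Variables (R : pzRingType) (M : lmodType R) (C : augmented M).

(** The augmentation acts as the differential leaving degree [0], so that one notion covers all
    degrees. *)
Definition is_cycle (n : nat) : term C n -> Prop :=
  match n with
  | 0%N => fun x => aug C x = 0
  | n'.+1 => fun x => bd C n' x = 0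
  end.

Lemma bd_cycle n x : is_cycle (bd C n x).
Proof. by case: n x => [|n] x; [apply: aug_bd|apply: bd_bd]. Qed.

Lemma exact_cycle : exact C ->
  forall n (x : term C n), is_cycle x -> exists y, bd C n y = x.
Proof. by case=> _ ex0 exS [|n] x; [apply: ex0|apply: exS]. Qed.
End Cycles.

Section Comparison.
Variables (R S : pzRingType) (f : {rmorphism R -> S}) (M : lmodType S).

(** On cycles the homotopy identity reduces to [d h = 1], so a contraction restricts to sections
    over cycles, the form used by [rel_lifting]; conversely such sections can be corrected to a
    contraction. *)
Lemma rel_exactP (C : augmented M) : rel_exact f C <->
  exists (s : {linear restr f M -> restr f (term C 0)})
         (t : forall n, {linear restr f (term C n) -> restr f (term C n.+1)}),
    (forall m, aug C (s m) = m) /\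
    forall n (x : term C n), is_cycle x -> bd C n (t n x) = x.
Proof.
split=> [[s [h [hs h0 hS]]]|[s [t [hs ht]]]].
  exists s, h; split=> // -[|n] x /= x0.
    by have := h0 x; rewrite x0 raddf0 addr0.
  by have := hS n x; rewrite x0 raddf0 addr0.
pose b n := restr_linear f (bd C n).
(* [h_n = t_n (1 - t_(n-1) d_(n-1))]: the second factor lands in the cycles,
   and [h_n] agrees with [t_n] on them. *)
pose h n : {linear restr f (term C n) -> restr f (term C n.+1)} :=
  match n with
  | 0%N => t 0%N \o (idfun \- (s \o restr_linear f (aug C)))
  | n'.+1 => t n'.+1 \o (idfun \- (t n' \o b n'))
  end.
exists s, h; split=> // [x|n x].
  rewrite /h /= ht; first exact: subrK.
  by rewrite /= raddfB /= hs subrr.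
have -> : h n (bd C n x) = t n (bd C n x).
  case: n x => [|n] x; rewrite /h /=; congr (t _ _).
    by rewrite aug_bd raddf0 subr0.
  by rewrite bd_bd raddf0 subr0.
rewrite /h /= ht; first exact: subrK.
by rewrite /= raddfB /= ht ?subrr //; apply: bd_cycle.
Qed.

Lemma comparison (C D : augmented M) :
  (forall n, rel_lifting f (term C n)) -> rel_exact f D ->
  exists F : forall n, {linear term C n -> term D n},
    (forall x, aug D (F 0%N x) = aug C x) /\
    forall n x, bd D n (F n.+1 x) = F n (bd C n x).
Proof.
move=> liftC /rel_exactP[s [t [hs ht]]].
(* Preserving cycles puts [u d] inside the cycles of [D], where [t n] splits the differential.
   Degree [0] also records compatibility with the augmentations. *)
pose P n (u : {linear term C n -> term D n}) :=
  (forall x, is_cycle x -> is_cycle (u x)) /\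
  match n return {linear term C n -> term D n} -> Prop with
  | 0%N => fun u => forall x, aug D (u x) = aug C x
  | _.+1 => fun=> True
  end u.
pose Q n (u : {linear term C n -> term D n})
    (u' : {linear term C n.+1 -> term D n.+1}) :=
  forall x, bd D n (u' x) = u (bd C n x).
have [||F [FP FQ]] := @dep_choice _ P Q.
- have [x|u hu] := @liftC 0%N _ _ (aug D) (aug C) s; first exact: hs.
  by exists u; split=> // x; rewrite /= hu.
- move=> n u [uc _].
  have [x|v hv] := @liftC n.+1 _ _ (bd D n) (u \o bd C n) (t n).
    by apply: ht; apply: uc; apply: bd_cycle.
  by exists v => //; split=> // x /= x0; rewrite hv /= x0 raddf0.
by exists F; split=> //; have [_] := FP 0%N.
Qed.

(** Only the restriction of [d h + h d = phi] to cycles is kept, where [h d] vanishes. This suffices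
    for the induction: it makes [phi - h d] land in the cycles one degree higher, so it lifts. *)
Lemma null_homotopy (C D : augmented M)
    (phi : forall n, {linear term C n -> term D n}) :
  (forall n, rel_lifting f (term C n)) -> rel_exact f D ->
  (forall x, aug D (phi 0%N x) = 0) ->
  (forall n x, bd D n (phi n.+1 x) = phi n (bd C n x)) ->
  forall n, exists h : {linear term C n -> term D n.+1},
    forall x, is_cycle x -> bd D n (h x) = phi n x.
Proof.
move=> liftC /rel_exactP[s [t [hs ht]]] phi0 phiS; elim=> [|n [h hh]].
  have [x|h hh] := @liftC 0%N _ _ (bd D 0) (phi 0%N) (t 0%N).
    by apply: ht; apply: phi0.
  by exists h.
have [x|k hk] :=
  @liftC n.+1 _ _ (bd D n.+1) (phi n.+1 \- (h \o bd C n)) (t n.+1).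
  apply: ht; rewrite /= raddfB /= phiS hh ?subrr //; exact: bd_cycle.
by exists k => x /= x0; rewrite hk /= x0 raddf0 subr0.
Qed.
End Comparison.

(** * Free modules and resolutions by free modules of finite rank *)

Section FreeModules.
Variable T : pzRingType.

Definition row_comb (X : lmodType T) (n : nat) (g : 'I_n -> X) (v : 'rV[T]_n) : X :=
  \sum_i v 0 i *: g i.

Lemma row_comb_linear (X : lmodType T) (n : nat) (g : 'I_n -> X) :
  linear (row_comb g).
Proof.
move=> a v w; rewrite scaler_sumr -big_split; apply: eq_bigr => i _.
by rewrite !mxE scalerDl scalerA.
Qed.

HB.instance Definition _ (X : lmodType T) n (g : 'I_n -> X) :=
  GRing.isLinear.Build T 'rV[T]_n X *:%R (@row_comb X n g)
    (@row_comb_linear X n g).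

Lemma row_comb_delta (n : nat) (v : 'rV[T]_n) : row_comb (delta_mx 0) v = v.
Proof.
apply/rowP => j; rewrite /row_comb summxE (bigD1 j) //= !mxE !eqxx mulr1.
rewrite big1 ?addr0 // => i /negPf nij.
by rewrite !mxE eq_sym nij mulr0.
Qed.

Lemma fin_gen_row (n : nat) : fin_gen 'rV[T]_n.
Proof.
by exists n, (delta_mx 0) => v; exists (v 0); rewrite -[LHS]row_comb_delta.
Qed.

Lemma projective_row (n : nat) : projective 'rV[T]_n.
Proof.
move=> X Y g u gsurj.
have /choice[x hx] i : exists x, g x = u (delta_mx 0 i) by apply: gsurj.
exists (row_comb x) => v; rewrite -[in RHS](row_comb_delta v) /= !linear_sum.
by apply: eq_bigr => i _; rewrite !linearZ hx.
Qed.

Lemma fin_gen_cover (X : lmodType T) : fin_gen X ->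
  exists n (p : {linear 'rV[T]_n -> X}), forall x, exists v, p v = x.
Proof.
move=> [n [g hg]]; exists n, (row_comb g) => x; have [c ->] := hg x.
by exists (\row_i c i); apply: eq_bigr => i _; rewrite mxE.
Qed.

Lemma fin_gen_image (X Y : lmodType T) (p : {linear X -> Y}) :
  fin_gen X -> (forall y, exists x, p x = y) -> fin_gen Y.
Proof.
move=> [n [g hg]] psurj; exists n, (p \o g) => y; have [x <-] := psurj y.
have [c ->] := hg x; exists c; rewrite linear_sum.
by apply: eq_bigr => i _; rewrite linearZ.
Qed.

Lemma projective_retract (P Q : lmodType T)
    (i : {linear P -> Q}) (r : {linear Q -> P}) :
  projective Q -> (forall x, r (i x) = x) -> projective P.
Proof.
move=> projQ ri X Y g u gsurj; have [h hh] := projQ X Y g (u \o r) gsurj.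
by exists (h \o i) => x; rewrite /= hh /= ri.
Qed.

(** The Noetherian property stated through images of free modules, so that kernels stay subsets of
    row spaces. *)
Definition free_noetherian : Prop :=
  forall m (N : set 'rV[T]_m), submod N ->
    exists n (p : {linear 'rV[T]_n -> 'rV[T]_m}), range p = N.

Lemma free_resolution (M : lmodType T) : free_noetherian -> fin_gen M ->
  exists C : augmented M, proj_resolution C.
Proof.
move=> noethT /fin_gen_cover[m0 [p0 p0surj]].
have kerP (X Y : lmodType T) (p : {linear X -> Y}) : submod [set v | p v = 0].
  split=> /= [|x y px py|a x px]; first by rewrite raddf0.
    by rewrite raddfD /= px py addr0.
  by rewrite linearZ /= px scaler0.
(* A state is a rank [m] with the submodule of [T^m] to be covered next, the kernel of the preceding
   map; [P] fixes the initial state as the kernel of [p0]. *)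
pose U := {m : nat & set 'rV[T]_m}.
pose P (n : nat) (u : U) := submod (projT2 u) /\
  (n = 0%N -> u = existT _ m0 [set v | p0 v = 0]).
pose Q (n : nat) (u u' : U) :=
  exists p : {linear 'rV[T]_(projT1 u') -> 'rV[T]_(projT1 u)},
    range p = projT2 u /\ [set v | p v = 0] = projT2 u'.
have [||u [uP uQ]] := @dep_choice (fun=> U) P Q.
- by exists (existT _ m0 [set v | p0 v = 0]); split=> //; apply: kerP.
- move=> n [m N] [/= Nsub _]; have [m' [p pN]] := noethT m N Nsub.
  by exists (existT _ m' [set v | p v = 0]); [split=> //; apply: kerP|exists p].
pose d n := sval (cid (uQ n)).
have dP n : range (d n) = projT2 (u n) /\ [set v | d n v = 0] = projT2 (u n.+1).
  exact: svalP (cid (uQ n)).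
(* The initial state is only provably equal to the prescribed one, so [p0] is transported along that
   equality. *)
have [e [esurj eker]] : exists e : {linear 'rV[T]_(projT1 (u 0%N)) -> M},
    (forall x, exists v, e v = x) /\ [set v | e v = 0] = projT2 (u 0%N).
  have [_ /(_ erefl) ->] := uP 0%N.
  by exists p0.
have ed x : e (d 0%N x) = 0.
  have : projT2 (u 0%N) (d 0%N x) by rewrite -(dP 0%N).1; exists x.
  by rewrite -eker.
have dd n x : d n (d n.+1 x) = 0.
  have : projT2 (u n.+1) (d n.+1 x) by rewrite -(dP n.+1).1; exists x.
  by rewrite -(dP n).2.
exists (@Augmented T M (fun n => 'rV[T]_(projT1 (u n))) d e ed dd); split; last first.
  by move=> n; split; [apply: fin_gen_row|apply: projective_row].
split=> //= [x x0|n x x0].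
  have : projT2 (u 0%N) x by rewrite -eker.
  by rewrite -(dP 0%N).1 => -[y]; exists y.
have : projT2 (u n.+1) x by rewrite -(dP n).2.
by rewrite -(dP n.+1).1 => -[y]; exists y.
Qed.
End FreeModules.

(** * Restriction of modules and resolutions along a surjection [q] *)

Section QuotientModules.
Variables (R S T : pzRingType) (f : {rmorphism R -> S}) (q : {rmorphism S -> T}).

Definition restr_augmented (M : lmodType T) (C : augmented M) :
    augmented (restr q M) :=
  @Augmented S (restr q M) (fun n => restr q (term C n))
    (fun n => restr_linear q (bd C n)) (restr_linear q (aug C))
    (@aug_bd T M C) (@bd_bd T M C).

Lemma restr_cycle (M : lmodType T) (C : augmented M) n (x : term C n) :
  @is_cycle _ _ (restr_augmented C) n x = is_cycle x.
Proof. by case: n x. Qed.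

Hypothesis qsurj : forall t, exists s, q s = t.

Lemma restr_linear_full (X Y : lmodType T) (u : {linear restr q X -> restr q Y}) :
  exists u' : {linear X -> Y}, forall x, u' x = u x.
Proof.
have ulin : linear (u : X -> Y).
  by move=> t x y; have [s <-] := qsurj t; exact: (linearP u s x y).
by exists (linear_pack ulin).
Qed.

Lemma fin_gen_restr (M : lmodType T) : fin_gen M -> fin_gen (restr q M).
Proof.
move=> [n [g hg]]; exists n, g => x; have [c ->] := hg x.
have /choice[s hs] i : exists s, q s = c i by apply: qsurj.
by exists s; apply: eq_bigr => i _; rewrite -hs.
Qed.

Hypothesis radT : forall r, jacobson r -> q (f r) = 0.
Hypothesis artR : left_artinian R.
Hypothesis projT : rel_projective f (restr q T^o).

(** Over [R] all these modules are killed by the radical, so each map has a pseudo-inverse, that is,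
    a section over its image; by exactness the images are the cycles and [M]. *)
Lemma restr_rel_exact (M : lmodType T) (C : augmented M) :
  exact C -> rel_exact f (restr_augmented C).
Proof.
move=> exC; apply/rel_exactP.
have J X : jacobson_trivial (restr f (restr q X)).
  by move=> r /radT h x; change (q (f r) *: (x : X) = 0); rewrite h scale0r.
have pinv (X Y : lmodType T) (g : {linear X -> Y}) :
    exists t : {linear restr f (restr q Y) -> restr f (restr q X)},
      forall x : X, g (t (g x)) = g x.
  exact: (linear_pseudo_inverse artR (restr_linear f (restr_linear q g))).
have [s hs] := pinv _ _ (aug C).
pose t n := sval (cid (pinv _ _ (bd C n))).
have ht n (x : term C n.+1) : bd C n (t n (bd C n x)) = bd C n x.
  exact: svalP (cid (pinv _ _ (bd C n))) x.
exists s, t; split=> [m|n x].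
  by have [/(_ m)[x <-] _ _] := exC; apply: hs.
by rewrite restr_cycle => /(exact_cycle exC)[y <-]; apply: ht.
Qed.

(** Dual basis argument: [p] is the sum of the [co i p *: g i], each map [t |-> u (t *: g i)] from
    [T] lifts to some [h i] by [projT], and the sum of the [h i (co i p)] lifts [u]. *)
Lemma restr_rel_lifting (P : lmodType T) :
  fin_gen P -> projective P -> rel_lifting f (restr q P).
Proof.
move=> [n [g hg]] projP X Y x u v huv.
have [|c hc] := projP _ _ (row_comb g) idfun.
  move=> y; have [c ->] := hg y.
  by exists (\row_i c i); apply: eq_bigr => i _; rewrite mxE.
have rho_lin i : linear (fun t : T^o => (t : T) *: g i : P).
  by move=> a b b'; rewrite scalerDl -scalerA.
pose rho i := restr_linear q (linear_pack (rho_lin i)).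
have /choice[h hh] i : exists h : {linear restr q T^o -> X},
    forall t, x (h t) = u (rho i t).
  have /rel_projectiveP := projT; move=> /(_ _ _ x (u \o rho i) v); apply.
  by move=> p; apply: huv.
have co_lin i : linear (fun p : P => c p 0 i : T^o).
  by move=> a p p'; rewrite linearP !mxE.
pose co i := restr_linear q (linear_pack (co_lin i)).
have k_lin : linear (fun p : restr q P => \sum_i h i (co i p)).
  move=> a p p'; rewrite scaler_sumr -big_split; apply: eq_bigr => i _.
  by rewrite !linearP.
exists (linear_pack k_lin) => p /=.
rewrite linear_sum -[p in RHS]hc /= /row_comb linear_sum.
by apply: eq_bigr => i _; rewrite hh.
Qed.

Lemma restr_rel_resolution (M : lmodType T) (C : augmented M) :
  proj_resolution C -> rel_proj_resolution f (restr_augmented C).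
Proof.
move=> [exC hC]; split; first exact: restr_rel_exact.
move=> n; have [gC pC] := hC n; split; first exact: fin_gen_restr.
exact/rel_projectiveP/restr_rel_lifting.
Qed.
End QuotientModules.

(** * Splitting idempotents *)

Section FixedPoints.
Variables (T : pzRingType) (X : lmodType T) (e : {linear X -> X}).

Definition fixed_mem : {pred X} := fun x => e x == x.

Lemma fixed_mem_submod : submod_closed fixed_mem.
Proof.
split=> [|a x y /eqP ex /eqP ey]; apply/eqP; first exact: raddf0.
by rewrite linearP ex ey.
Qed.

HB.instance Definition _ :=
  GRing.isSubmodClosed.Build T X fixed_mem fixed_mem_submod.

Record fixed_type := Fixed { fixed_val : X; _ : fixed_val \in fixed_mem }.

HB.instance Definition _ := [isSub for fixed_val].
HB.instance Definition _ := [Choice of fixed_type by <:].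
HB.instance Definition _ := [SubChoice_isSubLmodule of fixed_type by <:].

Lemma idempotent_split : (forall x, e (e x) = e x) ->
  exists (F : lmodType T) (i : {linear F -> X}) (r : {linear X -> F}),
    (forall y, r (i y) = y) /\ forall x, i (r x) = e x.
Proof.
move=> ee; have eP x : e x \in fixed_mem by apply/eqP.
have r_lin : linear (fun x => Fixed (eP x)).
  by move=> a x y; apply: val_inj; rewrite /= linearP.
exists fixed_type, (val : {linear fixed_type -> X}), (linear_pack r_lin).
by split=> // y; apply: val_inj => /=; apply/eqP; case: y.
Qed.
End FixedPoints.

(** * Truncating a projective resolution *)

Section Truncation.
Variables (T : pzRingType) (M : lmodType T) (Q : augmented M).

(* [e] is the identity below degree [n], [1 - d h] in degree [n], and [0] above. *)
Lemma truncation_idempotents (n : nat) (h : {linear term Q n -> term Q n.+1}) :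
  (forall z, bd Q n (h (bd Q n z)) = bd Q n z) ->
  forall i, exists e : {linear term Q i -> term Q i},
    [/\ forall x, e (e x) = e x,
        (i < n)%N -> forall x, e x = x,
        (i <= n)%N -> forall x, exists y, x - e x = bd Q i y,
        (n <= i)%N -> forall z, e (bd Q i z) = 0
      & (n < i)%N -> forall x, e x = 0].
Proof.
move=> hh i; case: (ltngtP i n) => [lt_in|lt_ni|E].
- exists idfun; split=> // _ x; exists 0.
  by rewrite subrr raddf0.
- by exists \0; split.
- rewrite {i}E; exists (idfun \- (bd Q n \o h)); split=> //= [x|_ x|_ z].
  + rewrite [h (_ - _)]raddfB [bd Q n (_ - _)]raddfB /= hh.
    by rewrite subrr subr0.
  + by exists (h x); rewrite subKr.
  + by rewrite hh subrr.
Qed.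

(** The terms [F i] are the images of the idempotents, with differentials [r d j]. Being retracts of
    the terms of [Q], they stay projective and finitely generated. *)
Lemma truncated_resolution (n : nat) (h : {linear term Q n -> term Q n.+1}) :
  proj_resolution Q -> (forall z, bd Q n (h (bd Q n z)) = bd Q n z) ->
  exists C : augmented M, proj_resolution C /\ length_le C n.
Proof.
move=> [exQ projQ] /truncation_idempotents idem.
have split_idem i : exists D : {F : lmodType T &
    ({linear F -> term Q i} * {linear term Q i -> F})%type},
    let j := (projT2 D).1 in let r := (projT2 D).2 in
    [/\ forall y, r (j y) = y,
        (i < n)%N -> forall x, j (r x) = x,
        (i <= n)%N -> forall x, exists y, x - j (r x) = bd Q i y,
        (n <= i)%N -> forall z, j (r (bd Q i z)) = 0
      & (n < i)%N -> forall x, j (r x) = 0].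
  have [e [ee e1 e2 e3 e4]] := idem i.
  have [F [j [r [rj jr]]]] := idempotent_split ee.
  exists (existT _ F (j, r)); split=> //= hi x; rewrite ?jr.
  - exact: e1.
  - exact: e2.
  - exact: e3.
  - exact: e4.
have [F [j [r H]]] : exists (F : nat -> lmodType T)
    (j : forall i, {linear F i -> term Q i})
    (r : forall i, {linear term Q i -> F i}), forall i,
    [/\ forall y, r i (j i y) = y,
        (i < n)%N -> forall x, j i (r i x) = x,
        (i <= n)%N -> forall x, exists y, x - j i (r i x) = bd Q i y,
        (n <= i)%N -> forall z, j i (r i (bd Q i z)) = 0
      & (n < i)%N -> forall x, j i (r i x) = 0].
  exists (fun i => projT1 (sval (cid (split_idem i)))),
    (fun i => (projT2 (sval (cid (split_idem i)))).1),
    (fun i => (projT2 (sval (cid (split_idem i)))).2) => i.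
  exact: (svalP (cid (split_idem i))).
have rj i : forall y, r i (j i y) = y by have [] := H i.
have jr_id i : (i < n)%N -> forall x, j i (r i x) = x by have [] := H i.
have jr_bd i : (i <= n)%N -> forall x, exists y, x - j i (r i x) = bd Q i y.
  by have [] := H i.
have jr_bd0 i : (n <= i)%N -> forall z, j i (r i (bd Q i z)) = 0.
  by have [] := H i.
have jr0 i : (n < i)%N -> forall x, j i (r i x) = 0 by have [] := H i.
have r0 i x : j i (r i x) = 0 -> r i x = 0.
  by move=> h0; rewrite -[LHS]rj h0 raddf0.
have F0 i (x : F i) : (n < i)%N -> x = 0.
  by move=> ni; rewrite -[LHS]rj; apply/r0/jr0.
pose b i : {linear F i.+1 -> F i} := r i \o (bd Q i \o j i.+1).
pose a : {linear F 0%N -> M} := aug Q \o j 0%N.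
(* Passing from [x] to its component in the image subtracts a boundary, which leaves the
   differential unchanged. *)
have bd_jr i : (i < n)%N -> forall x, bd Q i (j i.+1 (r i.+1 x)) = bd Q i x.
  move=> lt_in x; have [y /eqP] := jr_bd i.+1 lt_in x.
  rewrite subr_eq => /eqP xE; rewrite [in RHS]xE raddfD /= bd_bd.
  by rewrite add0r.
have ab x : a (b 0%N x) = 0.
  rewrite /a /b /=; case: (leqP n 0) => [n0|n0].
    by rewrite jr_bd0 // raddf0.
  by rewrite jr_id // aug_bd.
have bb i x : b i (b i.+1 x) = 0.
  case: (leqP n i.+1) => [ni|ni]; first by rewrite (F0 _ x) ?raddf0.
  by rewrite /b /= jr_id // bd_bd raddf0.
(* Below degree [n] a preimage in [Q] is projected to [F]; from degree [n] on the idempotent kills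
   boundaries, so [x] itself is [0]. *)
have exF i (x : F i) : is_cycle (j i x) -> exists y, b i y = x.
  move=> /(exact_cycle exQ)[y hy]; case: (ltnP i n) => [lt_in|le_ni].
    by exists (r i.+1 y); rewrite /b /= bd_jr // hy rj.
  exists 0; rewrite raddf0 -[RHS]rj -hy; apply/esym/r0.
  exact: jr_bd0.
exists (Augmented ab bb); split; last by move=> i lt_ni x; apply: F0.
split; first split=> /= [m|x x0|i x x0].
- have [/(_ m)[x <-] _ _] := exQ; exists (r 0%N x); rewrite /a /=.
  have [y /eqP] := jr_bd 0%N (leq0n n) x; rewrite subr_eq => /eqP xE.
  by rewrite [in RHS]xE raddfD /= aug_bd add0r.
- exact: exF.
(* Here [x] has degree [i + 1]: it is [0] if [n <= i], and otherwise [j r = 1] in degree [i] makes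
   [j x] a cycle of [Q]. *)
- case: (leqP n i) => [ni|ni]; last first.
    by apply: exF => /=; rewrite -(jr_id i ni (bd Q i _)) [r i _]x0 raddf0.
  by exists 0; rewrite (F0 _ x) // !raddf0.
move=> i; have [gQ pQ] := projQ i; split.
  by apply: (fin_gen_image (p := r i)) gQ _ => y; exists (j i y).
exact: projective_retract (rj i).
Qed.
End Truncation.

(** * Equality of absolute and relative projective dimension *)

Section QuotientComparison.
Variables (R S T : pzRingType) (f : {rmorphism R -> S}) (q : {rmorphism S -> T}).
Hypothesis qsurj : forall t, exists s, q s = t.
Hypothesis radT : forall r, jacobson r -> q (f r) = 0.
Hypothesis artR : left_artinian R.
Hypothesis noethT : free_noetherian T.
Hypothesis projT : rel_projective f (restr q T^o).

Lemma proj_resolution_of_rel (M : lmodType T) (D : augmented (restr q M)) n :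
  fin_gen M -> rel_proj_resolution f D -> length_le D n ->
  exists C : augmented M, proj_resolution C /\ length_le C n.
Proof.
move=> /(free_resolution noethT)[Q hQ] [exD projD] Dn.
have [exQ' projQ'] := restr_rel_resolution qsurj radT artR projT hQ.
set Q' := restr_augmented q Q in exQ' projQ'.
have liftQ i : rel_lifting f (term Q' i) by have [_ /rel_projectiveP] := projQ' i.
have liftD i : rel_lifting f (term D i) by have [_ /rel_projectiveP] := projD i.
have [F [F0 FS]] := comparison liftQ exD.
have [G [G0 GS]] := comparison liftD exQ'.
(* [phi] induces [0] on [M], hence is null-homotopic. *)
pose phi i : {linear term Q' i -> term Q' i} := idfun \- (G i \o F i).
have [x|i x|h hh] := @null_homotopy _ _ f _ Q' Q' phi liftQ exQ' _ _ n.
- by rewrite /phi /= raddfB /= G0 F0 subrr.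
- by rewrite /phi /= raddfB /= GS FS.
have [h' hE] := restr_linear_full qsurj h.
apply: (truncated_resolution (h := h')) => // z; rewrite hE.
(* [F d z = d F z] vanishes because [D] is zero in degree [n + 1]; thus [phi] fixes [d z], and
   [d h d z = d z]. *)
have := hh (bd Q' n z) (bd_cycle z); rewrite /phi /= -FS.
by rewrite [F n.+1 z](Dn n.+1) // !raddf0 => ->; exact: addr0.
Qed.

Theorem pd_eq_rel_pd (M : lmodType T) :
  fin_gen M -> pd M = rel_pd f (restr q M).
Proof.
move=> gM; congr least; apply/seteqP; split=> n /= [C [hC Cn]].
  exists (restr_augmented q C); split=> //.
  exact: restr_rel_resolution.
exact: proj_resolution_of_rel hC Cn.
Qed.
End QuotientComparison.

(** * Monotonicity of suprema in the extended naturals *)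

Lemma least_subset (E E' : set nat) : E' `<=` E -> enat_le (least E) (least E').
Proof.
move=> EE'; rewrite /least; case: pselect => [ex|nex].
  case: pselect => [ex'|nex'] //=; case: ex_minnP => m _ mmin.
  by case: ex_minnP => m' /asboolP /EE' E'm' _; apply: mmin; apply/asboolP.
case: pselect => // -[m Em]; case: nex; exists m; apply/asboolP; apply: EE'; exact/asboolP.
Qed.

Lemma enat_sup_subset (E E' : set enat) :
  E `<=` E' -> enat_le (enat_sup E) (enat_sup E').
Proof. by move=> EE'; apply: least_subset => n /= hn x /EE'; apply: hn. Qed.

(** * Chain conditions from finite dimension *)

Section FiniteDimension.
Variable k : fieldType.

(** Take [U] of maximal rank with row space inside [W]; a vector of [W] outside it would raise the
    rank. *)
Lemma subspace_row_space (n : nat) (W : set 'rV[k]_n) : submod W ->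
  exists U : 'M[k]_n, forall v, W v <-> (v <= U)%MS.
Proof.
move=> [W0 WD WZ].
pose P r := `[< exists2 U : 'M[k]_n, forall v : 'rV_n, (v <= U)%MS -> W v
                & \rank U = r >].
have exP : exists r, P r.
  exists 0%N; apply/asboolP; exists 0; last exact: mxrank0.
  by move=> v; rewrite submx0 => /eqP ->.
have leP r : P r -> (r <= n)%N by move=> /asboolP[U _ <-]; apply: rank_leq_row.
case: (ex_maxnP exP leP) => _ /asboolP[U UW <-] Umax.
exists U => v; split=> [Wv|]; last exact: UW.
apply: contrapT => /negP vU.
have : P (\rank (U + v)%MS).
  apply/asboolP; exists (U + v)%MS => // w /sub_addsmxP[[a c] /= ->].
  rewrite [c]mx11_scalar mul_scalar_mx; apply: WD; last exact: WZ.
  by apply: UW; apply: submxMl.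
move=> /Umax; apply/negP; rewrite -ltnNge; apply: rank_ltmx.
by rewrite /ltmx addsmxSl addsmx_sub submx_refl.
Qed.

Variable X : lmodType k.
Hypothesis gX : fin_gen X.

(** Pulling subspaces back along [p] encodes them all by matrices of one size, whose rank then
    serves as a measure. *)
Lemma subspace_cover : exists n (p : {linear 'rV[k]_n -> X})
    (U : set X -> 'M[k]_n), (forall x, exists v, p v = x) /\
  forall N, submod N -> forall v, N (p v) <-> (v <= U N)%MS.
Proof.
have [n [p psurj]] := fin_gen_cover gX; exists n, p.
have /choice[U hU] (N : set X) :
    exists U : 'M[k]_n, submod N -> forall v, N (p v) <-> (v <= U)%MS.
  have [[N0 ND NZ]|nN] := pselect (submod N); last by exists 0.
  have [|U hU] := @subspace_row_space n (p @^-1` N); last by exists U.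
  split=> /= [|v w Nv Nw|a v Nv]; first by rewrite raddf0.
    by rewrite raddfD; apply: ND.
  by rewrite linearZ; apply: NZ.
by exists U.
Qed.

Lemma subspace_minimal (F : set (set X)) :
  (forall N, F N -> submod N) -> F !=set0 ->
  exists2 N, F N & forall N', F N' -> N' `<=` N -> N `<=` N'.
Proof.
have [n [p [U [psurj hU]]]] := subspace_cover => Fsub [N1 FN1].
pose P r := `[< exists2 N, F N & \rank (U N) = r >].
have exP : exists r, P r by exists (\rank (U N1)); apply/asboolP; exists N1.
case: (ex_minnP exP) => _ /asboolP[N FN <-] Nmin; exists N => // N' FN' N'N x.
have [v <-] := psurj x => /(hU _ (Fsub _ FN)) vN; apply/(hU _ (Fsub _ FN')).
apply: submx_trans vN _.
have sub : (U N' <= U N)%MS.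
  apply/row_subP => i; apply/(hU _ (Fsub _ FN)); apply: N'N.
  by apply/(hU _ (Fsub _ FN')); apply: row_sub.
have := mxrank_leqif_sup sub => -[le_r <-].
by rewrite eqn_leq le_r; apply: Nmin; apply/asboolP; exists N'.
Qed.

Lemma subspace_fin_gen (N : set X) : submod N ->
  exists n (g : 'I_n -> X),
    (forall i, N (g i)) /\ forall x, N x -> exists c, x = row_comb g c.
Proof.
have [n [p [U [psurj hU]]]] := subspace_cover => /(hU N){}hU.
exists n, (fun i => p (row i (U N))); split=> [i|x].
  by apply/hU; apply: row_sub.
have [v <-] := psurj x => /hU/submxP[c ->]; exists c.
by rewrite mulmx_sum_row linear_sum; apply: eq_bigr => i _; rewrite linearZ.
Qed.
End FiniteDimension.

Lemma fin_gen_restr_trans (R T : pzRingType) (f : {rmorphism R -> T})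
    (M : lmodType T) :
  fin_gen (restr f T^o) -> fin_gen M -> fin_gen (restr f M).
Proof.
move=> [m [t ht]] [n [g hg]].
pose F (ij : 'I_n * 'I_m) : M := (t ij.2 : T) *: g ij.1.
exists #|{: 'I_n * 'I_m}|, (fun i => F (enum_val i)) => x.
have [c ->] := hg x.
have /choice[d hd] i : exists d, c i = \sum_j f (d j) * t j.
  by have [d hd] := ht (c i); exists d.
exists (fun i => d (enum_val i).1 (enum_val i).2).
transitivity (\sum_ij f (d ij.1 ij.2) *: F ij).
  rewrite -(pair_big xpredT xpredT (fun i j => f (d i j) *: F (i, j))) /=.
  apply: eq_bigr => i _; rewrite hd scaler_suml.
  by apply: eq_bigr => j _; rewrite scalerA.
by rewrite big_enum_val.
Qed.

(** * Chain conditions for the subalgebra and the quotient algebra *)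

Section ArtinAlgebra.
Variables (k : fieldType) (A : algType k) (B : subalgClosed A).
Hypothesis gA : @fin_gen k A.

Lemma subalg_left_artinian : left_artinian (subalg B).
Proof.
move=> F Fid [L1 FL1].
have [||_ [L FL <-] Lmin] :=
  @subspace_minimal k A gA [set N | exists2 L, F L & incl B @` L = N].
- move=> _ [L /Fid[L0 LD LM] <-]; split.
  + by exists 0.
  + by move=> _ _ [x Lx <-] [y Ly <-]; exists (x + y) => //; apply: LD.
  + move=> c _ [x Lx <-].
    (* Left ideals of [B] are [k]-subspaces, since scalars act through the elements [c%:A] of
       [B]. *)
    have cB : c%:A \in B by rewrite rpredZ ?rpred1.
    exists ((Subalg cB : subalg B) * x); first exact: LM.
    by rewrite /= mulr_algl.
- by exists (incl B @` L1), L1.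
exists L => // L' FL' L'L x Lx.
suff [y L'y /val_inj <- //] : (incl B @` L') (incl B x).
apply: Lmin; [by exists L'| |by exists x].
by move=> _ [y /L'L Ly <-]; exists y.
Qed.

Definition quot_scalar : {rmorphism k -> quot_radical B} :=
  quot_radical_map B \o in_alg A.

Lemma quot_radical_map_surj (t : quot_radical B) :
  exists s, quot_radical_map B s = t.
Proof. by exists (quot_repr t); apply: quot_reprK. Qed.

Lemma quot_radical_fin_gen : fin_gen (restr quot_scalar (quot_radical B)^o).
Proof.
have [n [g hg]] := gA; exists n, (fun i => quot_radical_map B (g i)) => t.
have [s <-] := quot_radical_map_surj t; have [c ->] := hg s; exists c.
by rewrite rmorph_sum; apply: eq_bigr => i _; rewrite -mulr_algl rmorphM.
Qed.

(** A submodule of a free module of finite rank is a subspace of a finite-dimensional [k]-space, and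
    its generators over [k] generate it over the quotient. *)
Lemma quot_radical_noetherian : free_noetherian (quot_radical B).
Proof.
move=> m N [N0 ND NZ].
have gX := fin_gen_restr_trans quot_radical_fin_gen (@fin_gen_row _ m).
have [|n [g [gN hg]]] := @subspace_fin_gen k _ gX N.
  by split=> // a x; apply: NZ.
pose gT : 'I_n -> 'rV[quot_radical B]_m := g.
exists n, (row_comb gT); apply/seteqP; split=> x /=.
  move=> [c _ <-]; apply: (big_ind N) => // i _.
  by apply: NZ; apply: gN.
move=> /hg[c ->]; exists (map_mx quot_scalar c) => //.
by apply: eq_bigr => i _; rewrite mxE.
Qed.
End ArtinAlgebra.

Theorem corollary3p10
  (k : fieldType) (hk : perfect_field k)
  (A : algType k) (hA : @fin_gen k A)
  (B : subalgClosed A)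
  (hproj : rel_projective (incl B)
             (restr (quot_radical_map B) (quot_radical B)^o)) :
  [/\ forall M : lmodType (quot_radical B), fin_gen M ->
        pd M = rel_pd (incl B) (restr (quot_radical_map B) M),
      enat_le (gldim (quot_radical B)) (rel_gldim (incl B))
    & gldim (quot_radical B) = None -> controllable B].
Proof.
have qsurj := @quot_radical_map_surj k A B.
have pdE (M : lmodType (quot_radical B)) : fin_gen M ->
    pd M = rel_pd (incl B) (restr (quot_radical_map B) M).
  apply: pd_eq_rel_pd => //.
  - move=> r Jr; rewrite -(rmorph0 (quot_radical_map B)); apply/quot_projP.
    by rewrite subr0 => I [_]; apply; exists r.
  - exact: subalg_left_artinian.
  - exact: quot_radical_noetherian.
(* By (1) every projective dimension over the quotient is the relative one of the restricted module,
   so the left supremum runs over a subset. *)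
have le_gldim : enat_le (gldim (quot_radical B)) (rel_gldim (incl B)).
  apply: enat_sup_subset => d [M [gM ->]].
  exists (restr (quot_radical_map B) M); split; last exact: pdE.
  exact: fin_gen_restr.
split=> // gldim_inf; rewrite /controllable gldim_inf.
by move: le_gldim; rewrite gldim_inf; case: (rel_gldim _).
Qed.
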